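(* Let $f$ be a continuous non-invertible map defined on an open set $V$ in $\mathbb{R}^2$ or in $\mathbb{R}$, which has an invariant basic set $\Lambda$, and let $W(\hat x)=\sum_{i\ge0}\beta^iU(x_{-i})$ be a utility function on the inverse limit $\hat\Lambda$ (as defined in the context). Then for any $\hat f$-invariant Borel probability measure $\hat\mu$ on $\hat\Lambda$, $$\int_{\hat\Lambda}W\,d\hat\mu=\frac{1}{1-\beta}\int_\Lambda U\,d\mu,\qquad\text{where }\mu=\pi_*(\hat\mu).$$ If in addition $f$ is hyperbolic on $\Lambda$, and if $\mu_0$ is the unique $f$-invariant measure of maximal entropy on $\Lambda$ and $\hat\mu_0$ is the unique measure of maximal entropy (for $\hat f$) on $\hat\Lambda$, then $\mu_0=\pi_*(\hat\mu_0)$ and $$\int_{\hat\Lambda}W\,d\hat\mu_0=\frac{1}{1-\beta}\int_\Lambda U\,d\mu_0.$$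
   Context: Basic set. A compact set $\Lambda$ with $f(\Lambda)=\Lambda$ is basic for $f$ if there is an open neighbourhood $V'$ of $\Lambda$ with $\Lambda=\bigcap_{n\in\mathbb{Z}}f^n(V')$ (for negative $n$, $f^n(V')$ denotes the preimage) and $f$ is topologically (forward) transitive on $\Lambda$. Inverse limit. $\hat\Lambda=\{\hat x=(x,x_{-1},x_{-2},\ldots):\ x_{-i}\in\Lambda,\ f(x_{-i})=x_{-i+1},\ i\ge1\}$ (with $x_0=x$), $\hat f(x,x_{-1},\ldots)=(f(x),x,x_{-1},\ldots)$, metric $d(\hat x,\hat y)=\sum_{i\ge0}\frac{d(x_{-i},y_{-i})}{2^i}$; $\pi:\hat\Lambda\to\Lambda$, $\pi(\hat x)=x$, is the canonical projection. Utility function. A utility function on $\hat\Lambda$ is $W(\hat x)=\sum_{i\ge0}\beta^iU(x_{-i})$, where $\beta\in(0,1)$ is the discount factor and: (a) if $\Lambda\subset(0,\infty)$, $U(x)=\frac{\min\{1,x\}^{1-\sigma}}{1-\sigma}+\frac{(2-\min\{1,x\})^{1-\gamma}}{1-\gamma}$, $x\in\Lambda$; (b) if $\Lambda\subset(0,1)\times(0,1)$, $U(x,y)=\frac{x^{1-\sigma}}{1-\sigma}+\frac{y^{1-\gamma}}{1-\gamma}$, $(x,y)\in\Lambda$; with $\sigma>0$, $\gamma>0$, $\sigma\ne1$, $\gamma\neq1$. So $\Lambda$ is assumed to lie in $(0,\infty)$ or in $(0,1)\times(0,1)$. Hyperbolicity (in the endomorphism sense). $f$, smooth near $\Lambda$,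 is hyperbolic on $\Lambda$ if over $\hat\Lambda$ there is a continuous splitting of the tangent spaces $T_x=E^s_x\oplus E^u_{\hat x}$ with $Df(E^s_x)\subset E^s_{f(x)}$, $Df(E^u_{\hat x})=E^u_{\hat f\hat x}$, and constants $C>0$, $0<\lambda<1$ such that $|Df^n v|\le C\lambda^n|v|$ for $v\in E^s_x$ and $|Df^nv|\ge C^{-1}\lambda^{-n}|v|$ for $v\in E^u_{\hat x}$, $n\ge0$. The expanding case ($E^s=0$) is included. A measure of maximal entropy is an invariant Borel probability measure whose measure-theoretic entropy equals the topological entropy. *)

(* Defs.v *)
From HB Require Import structures.
From mathcomp Require Import all_boot all_order all_algebra.
From mathcomp Require Import all_classical all_reals all_analysis.

Set Implicit Arguments.
Unset Strict Implicit.
Unset Printing Implicit Defensive.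

Import Order.TTheory GRing.Theory Num.Theory.
Import numFieldNormedType.Exports.

Local Open Scope classical_set_scope.
Local Open Scope ring_scope.

(* Partial maps are encoded as total maps [f : T -> T] whose values outside
   the domain [V] are never used: [itimage V f n A] is the set of the points
   f^n x with x \in A and x, f x, ..., f^(n-1) x \in V, and
   [itpreimage V f n A] is the set of the x such that
   x, f x, ..., f^(n-1) x \in V and f^n x \in A. *)
Section iterated_images.
Variables (T : Type) (V : set T) (f : T -> T).

Fixpoint itimage (n : nat) (A : set T) : set T :=
  if n is k.+1 then f @` (itimage k A `&` V) else A.

Fixpoint itpreimage (n : nat) (A : set T) : set T :=
  if n is k.+1 then V `&` f @^-1` (itpreimage k A) else A.

Definition zimage (n : int) (A : set T) : set T :=
  match n with Posz k => itimage k A | Negz k => itpreimage k.+1 A end.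

End iterated_images.

(* Transitivity is the existence of a dense forward orbit; in particular a
   basic set is nonempty. *)
Record basic_set (R : realType) (T : normedModType R) (V : set T) (f : T -> T) :=
  BasicSet {
    basic_carrier :> set T ;
    basic_compact : compact basic_carrier ;
    basic_image : f @` basic_carrier = basic_carrier ;
    basic_isolated : exists V' : set T,
      [/\ open V', basic_carrier `<=` V', V' `<=` V &
          basic_carrier = \bigcap_(n in [set: int]) zimage V f n V'] ;
    basic_transitive : exists2 x, basic_carrier x &
      basic_carrier `<=` closure [set iter n f x | n in [set: nat]] }.

Arguments basic_compact {R T V f} b : rename.
Arguments basic_image {R T V f} b : rename.
Arguments basic_isolated {R T V f} b : rename.
Arguments basic_transitive {R T V f} b : rename.

#[short(type="pmetricType")]
HB.structure Definition PointedMetric (R : numDomainType) :=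
  {M of Metric R M & Pointed M}.

Section basic_type.
Context {R : realType} {T : normedModType R} {V : set T} {f : T -> T}.
Variable L : basic_set V f.

(* [L] as a space of its own, with the subspace topology of [T]. *)
Definition basic_type : Type := set_type (basic_carrier L).

HB.instance Definition _ :=
  PseudoMetric.copy basic_type (set_type (basic_carrier L)).

Definition basic_dist (x y : basic_type) : R := `|set_val x - set_val y|.

Let basic_dist_ge0 x y : 0 <= basic_dist x y.
Proof. exact: normr_ge0. Qed.

Let basic_dist_positivity x y : basic_dist x y = 0 -> x = y.
Proof. by move=> /normr0_eq0/eqP; rewrite subr_eq0 => /eqP/val_inj. Qed.

Let ball_basic_dist (x : basic_type) (d : R) :
  ball x d = [set y | basic_dist x y < d].
Proof. by rewrite -(initial_ballE (f := set_val)) -ball_normE. Qed.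

HB.instance Definition _ := @PseudoMetric_isMetric.Build R basic_type
  basic_dist basic_dist_ge0 basic_dist_positivity ball_basic_dist.

Let basic_nonempty : exists x : T, x \in (L : set T).
Proof. by have [x Lx _] := basic_transitive L; exists x; apply/mem_set. Qed.

HB.instance Definition _ := isPointed.Build basic_type
  (SigSub (svalP (cid basic_nonempty)) : set_type (basic_carrier L)).

Fact basic_map_subproof (x : basic_type) : f (set_val x) \in (L : set T).
Proof.
by apply/mem_set; rewrite -[X in X _](basic_image L); exists (set_val x) => //;
  exact: set_valP.
Qed.

Definition basic_map (x : basic_type) : basic_type :=
  SigSub (basic_map_subproof x).

Fact basic_map_surj (x : basic_type) : exists y, basic_map y = x.
Proof.
have := set_valP x; rewrite -[X in X _](basic_image L) => -[y Ly fyx].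
by exists (SigSub (mem_set Ly)); exact/val_inj.
Qed.

Lemma basic_dist_bounded : exists M : R, forall x y, basic_dist x y <= M.
Proof.
have [N [_ NL]] : bounded_set (L : set T).
  exact: compact_bounded (basic_compact L).
exists ((N + 1) + (N + 1)) => x y; rewrite (le_trans (ler_normB _ _))//.
by apply: lerD; apply: NL; rewrite ?ltrDl//; exact: set_valP.
Qed.

End basic_type.
Arguments basic_type {R T V f} L.
Arguments basic_map {R T V f} L x.

Section inverse_limit.
Context {R : realType} {T : normedModType R} {V : set T} {f : T -> T}.
Variable L : basic_set V f.

(* [x i] stands for x_{-i}. *)
Definition invlim : Type := set_type
  [set x : nat -> basic_type L | forall i, basic_map L (x i.+1) = x i].

Definition invlim_coord (x : invlim) (i : nat) : basic_type L := set_val x i.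

Definition invlim_proj (x : invlim) : basic_type L := invlim_coord x 0.

Fact invlim_map_subproof (x : invlim) :
  (fun i => if i is k.+1 then invlim_coord x k else basic_map L (invlim_proj x))
  \in [set x : nat -> basic_type L | forall i, basic_map L (x i.+1) = x i].
Proof. by apply/mem_set => -[|i] //=; exact: set_valP x i. Qed.

Definition invlim_map (x : invlim) : invlim := SigSub (invlim_map_subproof x).

Definition invlim_dist (x y : invlim) : R :=
  limn (series (fun i => mdist (invlim_coord x i) (invlim_coord y i) / 2 ^+ i)).

Lemma is_cvg_invlim_dist (x y : invlim) :
  cvgn (series
    (fun i => mdist (invlim_coord x i) (invlim_coord y i) / 2 ^+ i : R)).
Proof.
have [M dM] := basic_dist_bounded L.
apply: (@series_le_cvg _ _ (geometric M 2^-1)).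
- by move=> i; rewrite divr_ge0// mdist_ge0.
- move=> i; rewrite /= mulr_ge0 ?exprn_ge0 ?invr_ge0//.
  exact: le_trans (normr_ge0 _) (dM (invlim_coord x i) (invlim_coord x i)).
- by move=> i; rewrite /= exprVn ler_wpM2r ?invr_ge0 ?exprn_ge0//; exact: dM.
- apply: is_cvg_geometric_series; rewrite ger0_norm ?invr_ge0//.
  by rewrite invf_lt1// ltr1n.
Qed.

Arguments is_cvg_invlim_dist : clear implicits.

HB.instance Definition _ := Choice.on invlim.

Let invlim_distxx x : invlim_dist x x = 0.
Proof.
rewrite /invlim_dist (_ : series _ = cst 0) ?lim_cst//.
by apply/funext => n; rewrite /series/= big1// => i _; rewrite mdistxx mul0r.
Qed.

Let invlim_dist_positivity x y : invlim_dist x y = 0 -> x = y.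
Proof.
move=> xy0; apply/val_inj/funext => i; apply: (@mdist_positivity R).
apply/eqP; rewrite eq_le mdist_ge0 andbT.
rewrite -(@ler_pM2r _ (2 ^+ i)^-1) ?invr_gt0 ?exprn_gt0// mul0r -xy0.
have term_ge0 k :
    (0 : R) <= mdist (invlim_coord x k) (invlim_coord y k) / 2 ^+ k.
  by rewrite divr_ge0// mdist_ge0.
have nd : nondecreasing_seq (series
    (fun i => mdist (invlim_coord x i) (invlim_coord y i) / 2 ^+ i : R)).
  by apply/nondecreasing_seqP => n; rewrite /series/= big_nat_recr//= lerDl.
apply: (le_trans _ (nondecreasing_cvgn_le nd (is_cvg_invlim_dist x y) i.+1)).
by rewrite /series/= big_nat_recr//= lerDr sumr_ge0.
Qed.

Let invlim_dist_sym x y : invlim_dist x y = invlim_dist y x.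
Proof.
rewrite /invlim_dist; congr (limn (series _)); apply/funext => i.
by rewrite metric_sym.
Qed.

Let invlim_dist_triangle y x z :
  invlim_dist x z <= invlim_dist x y + invlim_dist y z.
Proof.
rewrite -lim_seriesD; [|exact: is_cvg_invlim_dist..].
apply: lim_series_le; [exact: is_cvg_invlim_dist| |].
  by apply: is_cvg_seriesD; exact: is_cvg_invlim_dist.
by move=> i; rewrite /= -mulrDl ler_wpM2r ?invr_ge0 ?exprn_ge0//
  metric_triangle.
Qed.

HB.instance Definition _ := @isMetric.Build R invlim invlim_dist
  invlim_distxx invlim_dist_positivity invlim_dist_sym invlim_dist_triangle.

Let prehistory (i : nat) : basic_type L :=
  iter i (fun x => sval (cid (basic_map_surj x))) point.

Let prehistoryP : prehistory \in
  [set x : nat -> basic_type L | forall i, basic_map L (x i.+1) = x i].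
Proof. by apply/mem_set => i; rewrite /prehistory/=; case: cid. Qed.

HB.instance Definition _ := isPointed.Build invlim (SigSub prehistoryP).

End inverse_limit.
Arguments invlim {R T V f} L.
Arguments is_cvg_invlim_dist {R T V f L} x y.
Arguments invlim_map {R T V f} L x.
Arguments invlim_proj {R T V f} L x.

Definition borel (X : ptopologicalType) : Type := g_sigma_algebraType (@open X).

HB.instance Definition _ (X : ptopologicalType) :=
  Measurable.on (borel X).

Section entropy.
Context {R : realType} (X : pmetricType R) (F : X -> X).
Implicit Type mu : probability (borel X) R.

Definition invariant_measure mu :=
  forall A : set (borel X), measurable A -> mu (F @^-1` A) = mu A.

(* Finite measurable partitions of [X] are encoded by their labellings
   [p : X -> 'I_k]; the labelling of the join of p, F^-1 p, ..., F^-(n-1) p is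
   then the itinerary map below. *)
Definition itinerary k (p : X -> 'I_k) (n : nat) (x : X) : {ffun 'I_n -> 'I_k} :=
  [ffun i : 'I_n => p (iter i F x)].

(* Since [ln 0 = 0], blocks of measure 0 contribute 0. *)
Definition partition_entropy mu (J : finType) (q : X -> J) : R :=
  - \sum_(j : J) (let t := fine (mu (q @^-1` [set j])) in t * ln t).

(* The sequence converges, by subadditivity. *)
Definition entropy_wrt mu k (p : X -> 'I_k) : \bar R :=
  limn_esup (fun n => (partition_entropy mu (itinerary p n) / n%:R)%:E).

Definition measure_entropy mu : \bar R :=
  ereal_sup [set h | exists k (p : X -> 'I_k),
    (forall j, measurable (p @^-1` [set j] : set (borel X))) /\
    h = entropy_wrt mu p].

Definition spanning (n : nat) (e : R) (s : seq X) :=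
  forall x, exists2 y, y \in s &
    forall i, (i < n)%N -> mdist (iter i F x) (iter i F y) <= e.

Definition ln_span (n : nat) (e : R) : \bar R :=
  ereal_inf [set (ln (size s)%:R)%:E | s in spanning n e].

(* Bowen's definition; the limit as e tends to 0 is a supremum by
   monotonicity. *)
Definition topological_entropy : \bar R :=
  ereal_sup [set limn_esup (fun n => n%:R^-1%:E * ln_span n e)%E
            | e in [set e : R | 0 < e]].

Definition max_entropy_measure mu :=
  invariant_measure mu /\ measure_entropy mu = topological_entropy.

Definition unique_max_entropy_measure mu :=
  max_entropy_measure mu /\
  forall nu : probability (borel X) R, max_entropy_measure nu ->
    forall A : set (borel X), measurable A -> nu A = mu A.

End entropy.

Section hyperbolicity.
Context {R : realType} {T : normedModType R} {V : set T} {f : T -> T}.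
Variable L : basic_set V f.

(* [f] is continuously differentiable near [L]; in finite dimension,
   continuity of the differential can be tested vector by vector. *)
Definition smooth_near := exists O : set T,
  [/\ open O, (L : set T) `<=` O, O `<=` V,
      forall x, O x -> differentiable f x &
      forall v x, O x -> {for x, continuous (fun y => 'd f y v)}].

Definition tangent_iter (n : nat) (x : basic_type L) (v : T) : T :=
  'd (iter n f) (set_val x) v.

Local Notation D := tangent_iter.

(* The splitting is continuous when its projections are: [P x] is the
   projection onto [Es] along [Eu]. *)
Definition hyperbolic := smooth_near /\
  exists (Es : basic_type L -> set T) (Eu : invlim L -> set T)
         (P : invlim L -> T -> T) (C lambda : R),
  [/\ [/\ (forall x, GRing.submod_closed (mem (Es x))),
      (forall x, GRing.submod_closed (mem (Eu x))),
      (forall x, Es (invlim_proj L x) `&` Eu x = [set 0]),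
      (forall x v, Es (invlim_proj L x) (P x v) /\ Eu x (v - P x v)) &
      (forall v, continuous (fun x => P x v))],
   [/\ (forall x, D 1 x @` Es x `<=` Es (basic_map L x)) &
      (forall x, D 1 (invlim_proj L x) @` Eu x = Eu (invlim_map L x))] &
   [/\ 0 < C, 0 < lambda < 1,
      (forall x v n, Es x v -> `|D n x v| <= C * lambda ^+ n * `|v|) &
      (forall x v n, Eu x v ->
        C^-1 * lambda ^- n * `|v| <= `|D n (invlim_proj L x) v|)]].

End hyperbolicity.

(* The norm of the product [R^o * R^o] is the sup norm. Borel sets, entropies
   and hyperbolicity do not depend on the choice of a norm on the plane. *)
Inductive ambient := Line | Plane.

Definition phase (R : realType) (m : ambient) : normedModType R :=
  match m with Line => R^o | Plane => (R^o * R^o)%type end.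

Section utility.
Context {R : realType}.

Definition utility_domain (m : ambient) : set (phase R m) :=
  match m with
  | Line => [set x : R | 0 < x]
  | Plane => [set p : R * R | 0 < p.1 < 1 /\ 0 < p.2 < 1]
  end.

Definition utility (sigma gamma : R) (m : ambient) : phase R m -> R :=
  match m with
  | Line => fun x : R => Num.min 1 x `^ (1 - sigma) / (1 - sigma)
                       + (2 - Num.min 1 x) `^ (1 - gamma) / (1 - gamma)
  | Plane => fun p : R * R => p.1 `^ (1 - sigma) / (1 - sigma)
                            + p.2 `^ (1 - gamma) / (1 - gamma)
  end.

Definition total_utility (beta : R) {m : ambient} (U : phase R m -> R)
    {V : set (phase R m)} {f : phase R m -> phase R m} {L : basic_set V f}
    (x : invlim L) : R :=
  limn (series (fun i => beta ^+ i * U (set_val (invlim_coord x i)))).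

End utility.
Arguments utility_domain {R} m _.
Arguments utility {R} sigma gamma m _.

(* Main.v *)
Require Import Defs.
From mathcomp Require Import all_boot all_order all_algebra.
From mathcomp Require Import all_classical all_reals all_analysis.
From mathcomp Require Import measurable_realfun ring lra.

(** The inverse limit carries the same dynamics as the basic set, so both halves
    of the theorem come from comparing a system with its natural extension.
    Write g for the map on the basic set, F for the shift on histories, and
    [coord n] for the coordinate x_{-n}.

    Integral formula. Prepending a state to a history gives
      W (F x) = U (pi (F x)) + beta W x.
    The utility is continuous on a compact set, so U and W are bounded and
    integrable; integrating the relation against an F-invariant measure yields
    (1 - beta) int W = int U o pi, with no exchange of sum and integral
    ([discounted_map], [integral_discounted]).

    Maximal entropy. If nu is the image under pi of an F-invariant measure
    muhat, then muhat and nu have the same entropy ([measure_entropy_proj]) and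
    F and g have the same topological entropy ([topological_entropy_invlim]).
    So the image of a measure of maximal entropy is again one, and uniqueness
    identifies it with mu0.

    - Topological entropies: pi is a 1-Lipschitz factor map, which gives one
      inequality. For the other, a history is known up to a small error once
      x_{-N} is known up to a small error along its orbit, so an (n + N)-spanning
      set of the basic set lifts to an n-spanning set of the inverse limit; the
      shift by N disappears in the exponential growth rate.

    - Measure entropies: each [coord n] intertwines F and g and, by invariance,
      carries muhat to nu, so partitions pulled back along [coord n] have the
      same entropy above and below ([entropy_wrt_coord]).  Open sets of the
      inverse limit are countable unions of sets seen by one coordinate
      ([invlim_open_cylinders]), hence every finite Borel partition is close in
      measure to a partition of this kind ([labelling_cylinder_approx]).
      It remains to see that the entropy of a partition is continuous for this
      closeness ([entropy_wrt_close]). This follows from a single convexity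
      inequality ([conditional_gibbs]): the joint entropy of one itinerary is
      bounded by that of the other plus the cost of guessing it letter by
      letter with a noisy copy kernel ([kernel_entropy_bound]), and this cost
      is n times a quantity that is small when the two partitions rarely
      disagree ([shannon_close]). *)

Set Implicit Arguments.
Unset Strict Implicit.
Unset Printing Implicit Defensive.

Import Order.TTheory GRing.Theory Num.Theory.
Import numFieldNormedType.Exports.

Local Open Scope classical_set_scope.
Local Open Scope ring_scope.

(** * Shannon entropy of finite labellings *)

Lemma ln_le_subr1 (R : realType) (x : R) : 0 < x -> ln x <= x - 1.
Proof.
by move=> x0; rewrite -[in leLHS](subrKC 1 x) le_ln1Dx// ltrBrDl subrr.
Qed.

Lemma ln_prod (R : realType) (I : finType) (F : I -> R) :
  (forall i, 0 < F i) -> ln (\prod_i F i) = \sum_i ln (F i).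
Proof.
move=> F0; suff [] : 0 < \prod_i F i /\ ln (\prod_i F i) = \sum_i ln (F i) by [].
elim/big_rec2: _ => [|i x y _ [y0 <-]]; first by rewrite ltr01 ln1.
by rewrite mulr_gt0// lnM ?posrE.
Qed.

(** The entropy of the first marginal is at most that of the second plus the
    cross-entropy of the conditional law relative to any kernel [Q].  Summand by
    summand, [ln t <= t - 1] at [t = PB b * Q a b / PA a], multiplied by
    [P a b <= PA a], leaves [PB b * Q a b - P a b], and these terms add up to 0
    because [Q] is stochastic. *)
Lemma conditional_gibbs (R : realType) (A B : finType) (P Q : A -> B -> R)
    (PA : A -> R) (PB : B -> R) :
  (forall a, PA a = \sum_b P a b) -> (forall b, PB b = \sum_a P a b) ->
  (forall a b, 0 <= P a b) -> (forall a b, 0 < Q a b) ->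
  (forall b, \sum_a Q a b = 1) ->
  - (\sum_a PA a * ln (PA a)) <=
  - (\sum_b PB b * ln (PB b)) + \sum_a \sum_b P a b * - ln (Q a b).
Proof.
move=> PAE PBE P0 Q0 Q1.
(* All entropies become sums over pairs, to be compared term by term. *)
have EA : \sum_a PA a * ln (PA a) = \sum_a \sum_b P a b * ln (PA a).
  by apply: eq_bigr => a _; rewrite PAE mulr_suml.
have EB : \sum_b PB b * ln (PB b) = \sum_a \sum_b P a b * ln (PB b).
  by rewrite exchange_big; apply: eq_bigr => b _; rewrite PBE mulr_suml.
rewrite EA EB -!sumrN -big_split/=.
under eq_bigr do rewrite -sumrN.
under [leRHS]eq_bigr do rewrite -sumrN -big_split/=.
rewrite -subr_le0 -sumrB.
under eq_bigr do rewrite -sumrB.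
apply: (@le_trans _ _ (\sum_a \sum_b (PB b * Q a b - P a b))); last first.
  under eq_bigr do rewrite sumrB.
  rewrite sumrB exchange_big/=.
  under eq_bigr do rewrite -mulr_sumr Q1 mulr1.
  rewrite -[X in X - _](eq_bigr _ (fun b _ => esym (PBE b))).
  by rewrite exchange_big/= subrr.
apply: ler_sum => a _; apply: ler_sum => b _.
have PA_ge : P a b <= PA a by rewrite PAE (bigD1 b)//= lerDl sumr_ge0.
have PB_ge : P a b <= PB b by rewrite PBE (bigD1 a)//= lerDl sumr_ge0.
have [Pab0|Pab0] := eqVneq (P a b) 0.
  rewrite Pab0 !mul0r !(oppr0, addr0, subr0) mulr_ge0 ?(ltW (Q0 _ _))//.
  by rewrite PBE sumr_ge0.
have Pab_gt0 : 0 < P a b by rewrite lt0r Pab0 P0.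
have PA0 : 0 < PA a by exact: lt_le_trans PA_ge.
have PB0 : 0 < PB b by exact: lt_le_trans PB_ge.
have -> : - (P a b * ln (PA a)) - (- (P a b * ln (PB b)) + P a b * - ln (Q a b))
    = P a b * ln (PB b * Q a b / PA a).
  rewrite ln_div ?posrE ?mulr_gt0// lnM ?posrE//; ring.
apply: le_trans (_ : P a b * (PB b * Q a b / PA a - 1) <= _).
  by rewrite ler_pM2l// ln_le_subr1// !mulr_gt0 ?invr_gt0.
rewrite mulrBr mulr1 lerB// mulrCA ger_pMr ?mulr_gt0// ler_pdivrMr// mul1r //.
Qed.

Section labellings.
Context d (X : measurableType d) (R : realType) (mu : probability X R).

Definition measurable_labelling (J : finType) (p : X -> J) :=
  forall j, measurable (p @^-1` [set j]).

Definition mass (J : finType) (p : X -> J) (j : J) : R :=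
  fine (mu (p @^-1` [set j])).

(** For a Borel probability this is convertible to [partition_entropy]. *)
Definition shannon (J : finType) (p : X -> J) : R :=
  - \sum_j mass p j * ln (mass p j).

Lemma labelling_preimage (J : finType) (p : X -> J) (B : set J) :
  measurable_labelling p -> measurable (p @^-1` B).
Proof.
move=> mp; have -> : p @^-1` B = \bigcup_(j in B) (p @^-1` [set j]).
  by rewrite -preimage_bigcup bigcup_imset1 image_id.
by apply: fin_bigcup_measurable => //; exact: finite_finset.
Qed.

Lemma labelling_comp (J K : finType) (p : X -> J) (h : J -> K) :
  measurable_labelling p -> measurable_labelling (h \o p).
Proof. by move=> mp k; rewrite comp_preimage; exact: labelling_preimage. Qed.

Lemma labelling_pair (J K : finType) (p : X -> J) (q : X -> K) :
  measurable_labelling p -> measurable_labelling q ->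
  measurable_labelling (fun x => (p x, q x)).
Proof.
move=> mp mq [j k]; rewrite [X in measurable X](_ : _ =
  (p @^-1` [set j]) `&` (q @^-1` [set k])); first exact: measurableI.
by apply/seteqP; split => x /=; [case=> -> ->|case=> -> ->].
Qed.

Lemma labelling_ffun (n : nat) (J : finType) (p : 'I_n -> X -> J) :
  (forall i, measurable_labelling (p i)) ->
  measurable_labelling (fun x => [ffun i => p i x]).
Proof.
move=> mp g; rewrite [X in measurable X](_ : _ =
  \bigcap_(i in [set: 'I_n]) (p i @^-1` [set g i])); last first.
  apply/seteqP; split => x /=; first by move=> <- i _ /=; rewrite ffunE.
  by move=> xg; apply/ffunP => i; rewrite ffunE; exact: xg.
by apply: fin_bigcap_measurable => [|i _]; [exact: finite_finset|exact: mp].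
Qed.

Lemma mass_ge0 (J : finType) (p : X -> J) j : 0 <= mass p j.
Proof. exact: fine_ge0. Qed.

Lemma mass_comp (J K : finType) (p : X -> J) (h : J -> K) k :
  measurable_labelling p -> mass (h \o p) k = \sum_(j | h j == k) mass p j.
Proof.
move=> mp; rewrite /mass comp_preimage.
have -> : p @^-1` (h @^-1` [set k]) =
    \bigcup_(j in h @^-1` [set k]) (p @^-1` [set j]).
  by rewrite -preimage_bigcup bigcup_imset1 image_id.
rewrite measure_fin_bigcup//; last first.
- by move=> i j _ _ [x [/= <- <-]].
- exact: finite_finset.
rewrite fsbig_finite/=; last exact: finite_finset.
rewrite -sum_fine; last by move=> j _; rewrite fin_num_measure.
rewrite -[RHS]big_filter; apply: perm_big; apply: uniq_perm.
- exact: finmap.fset_uniq.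
- exact/filter_uniq/index_enum_uniq.
- move=> j; rewrite in_fset_set; last exact: finite_finset.
  by rewrite mem_filter mem_index_enum andbT; apply/idP/eqP => [/set_mem|/mem_set].
Qed.

Lemma mass_sum (J : finType) (p : X -> J) :
  measurable_labelling p -> \sum_j mass p j = 1.
Proof.
move=> mp; have := mass_comp (fun=> tt) tt mp.
rewrite /mass [X in mu X](_ : _ = setT); last by apply/seteqP.
by rewrite probability_setT/= => ->.
Qed.

Lemma mass_mismatch (J : finType) (p q : X -> J) :
  measurable_labelling p -> measurable_labelling q ->
  \sum_(jk | jk.1 != jk.2) mass (fun x => (p x, q x)) jk =
  fine (mu [set x | p x != q x]).
Proof.
move=> mp mq; have mpq := labelling_pair mp mq.
have := mass_comp (fun jk => jk.1 != jk.2) true mpq.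
rewrite [in X in X -> _]/mass [X in fine (mu X)](_ : _ = [set x | p x != q x]) => [->|].
  by apply: eq_bigl => jk; rewrite eqb_id.
by apply/seteqP; split => x.
Qed.

(** Guessing the word [p] from the word [q] with the product kernel built from
    [c] makes the cross-entropy additive over letters, so that it depends only
    on the laws of the pairs [(p i, q i)].  This replaces the chain rule and the
    monotonicity of conditional entropy. *)
Lemma kernel_entropy_bound (J : finType) (n : nat) (p q : 'I_n -> X -> J)
    (c : J -> J -> R) :
  (forall i, measurable_labelling (p i)) -> (forall i, measurable_labelling (q i)) ->
  (forall j k, 0 < c j k) -> (forall k, \sum_j c j k = 1) ->
  shannon (fun x => [ffun i => p i x]) <= shannon (fun x => [ffun i => q i x]) +
    \sum_(i < n) \sum_jk mass (fun x => (p i x, q i x)) jk * - ln (c jk.1 jk.2).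
Proof.
move=> mp mq c0 c1.
set P := fun x => [ffun i => p i x]; set Q := fun x => [ffun i => q i x].
have mP : measurable_labelling P by exact: labelling_ffun.
have mQ : measurable_labelling Q by exact: labelling_ffun.
have mPQ := labelling_pair mP mQ.
pose PQ a b := mass (fun x => (P x, Q x)) (a, b).
pose Kc (a b : {ffun 'I_n -> J}) := \prod_i c (a i) (b i).
have margP a : mass P a = \sum_b PQ a b.
  have -> := mass_comp fst a mPQ.
  by rewrite (reindex_onto (pair a) snd) => [|[? ?] /= /eqP ->//];
     apply: eq_bigl => b /=; rewrite !eqxx.
have margQ b : mass Q b = \sum_a PQ a b.
  have -> := mass_comp snd b mPQ.
  by rewrite (reindex_onto (fun a => (a, b)) fst) => [|[? ?] /= /eqP ->//];
     apply: eq_bigl => a /=; rewrite !eqxx.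
have K0 a b : 0 < Kc a b by apply: prodr_gt0 => i _.
have K1 b : \sum_a Kc a b = 1.
  by rewrite -(bigA_distr_bigA (fun i j => c j (b i)))/= big1.
have /le_trans -> // := conditional_gibbs margP margQ (fun _ _ => mass_ge0 _ _) K0 K1.
rewrite lerD2l le_eqVlt; apply/orP; left; apply/eqP.
rewrite (pair_big xpredT xpredT)/=.
rewrite (eq_bigr (fun ab => \sum_(i < n) mass (fun x => (P x, Q x)) ab *
    - ln (c (ab.1 i) (ab.2 i)))); last first.
  move=> [a b] _; rewrite -mulr_sumr/= [in RHS]sumrN; congr (_ * - _).
  by rewrite /Kc ln_prod.
rewrite exchange_big/=; apply: eq_bigr => i _.
rewrite (partition_big (fun ab : {ffun 'I_n -> J} * {ffun 'I_n -> J} =>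
  (ab.1 i, ab.2 i)) xpredT)//=.
apply: eq_bigr => -[j k] _ /=.
rewrite [in RHS](_ : (fun x => (p i x, q i x)) =
    (fun ab : {ffun 'I_n -> J} * {ffun 'I_n -> J} => (ab.1 i, ab.2 i)) \o
    (fun x => (P x, Q x))); last first.
  by apply/funext => x; rewrite /= !ffunE.
rewrite (mass_comp _ (j, k) mPQ) mulr_suml.
by apply: eq_bigr => ab /eqP[-> ->].
Qed.

(** The kernel copies the letter with probability close to 1 and otherwise
    resamples it uniformly: copying costs at most [eps / 2], while a mismatch has
    a finite cost, fixed before [n], which is paid with probability at most
    [eta]. *)
Lemma shannon_close (J : finType) (eps : R) : 0 < eps ->
  exists2 eta : R, 0 < eta & forall n (p q : 'I_n -> X -> J),
    (forall i, measurable_labelling (p i)) -> (forall i, measurable_labelling (q i)) ->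
    (forall i, fine (mu [set x | p i x != q i x]) <= eta) ->
    shannon (fun x => [ffun i => p i x]) <=
    shannon (fun x => [ffun i => q i x]) + n%:R * eps.
Proof.
move=> eps0; pose e := eps / 2; have e0 : 0 < e by rewrite divr_gt0.
(* The weight (1 + e)^-1 is chosen because its cost ln (1 + e) is at most e. *)
pose N : R := #|J|%:R; pose off := (1 + e)^-1 * (e / N).
pose c (j k : J) : R := (1 + e)^-1 * ((j == k)%:R + e / N).
exists (e / (`|ln off| + 1)); first by rewrite divr_gt0// ltr_wpDl.
move=> n p q mp mq pq.
have N0 (j : J) : 0 < N by rewrite ltr0n; apply/card_gt0P; exists j.
have e1 : 0 < 1 + e by rewrite addr_gt0.
have c0 j k : 0 < c j k.
  by rewrite mulr_gt0 ?invr_gt0// ltr_wpDl// divr_gt0// N0.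
have c1 k : \sum_j c j k = 1.
  rewrite -mulr_sumr big_split/= sumr_const -/N -[_ *+ _]mulr_natr.
  rewrite -mulrA mulVf ?gt_eqF ?N0// (bigD1 k)//= eqxx big1 => [|j /negbTE->//].
  by rewrite addr0 mulr1 mulVf ?gt_eqF.
apply: le_trans (kernel_entropy_bound mp mq c0 c1) _.
rewrite lerD2l mulr_natl -[in leRHS](card_ord n) -sumr_const; apply: ler_sum => i _.
have mpq := labelling_pair (mp i) (mq i).
rewrite [leRHS](splitr eps) (bigID (fun jk => jk.1 == jk.2))/= -/e lerD//.
  apply: (@le_trans _ _ (\sum_(jk : J * J | jk.1 == jk.2)
      mass (fun x => (p i x, q i x)) jk * e)).
    apply: ler_sum => -[j k] /= /eqP <-; rewrite ler_wpM2l ?mass_ge0//.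
    rewrite /c eqxx lnM ?posrE ?invr_gt0//; last first.
      by rewrite ltr_pwDl// divr_ge0// ltW// N0.
    rewrite lnV ?posrE// opprD opprK -[leRHS]subr0 lerB//.
      by rewrite le_ln1Dx// (lt_trans _ e0)// ltrN10.
    by rewrite ln_ge0// lerDl divr_ge0// ltW// N0.
  rewrite -mulr_suml ler_piMl ?(ltW e0)//.
  rewrite -(mass_sum mpq) [leRHS](bigID (fun jk => jk.1 == jk.2))/= lerDl.
  by rewrite sumr_ge0// => *; exact: mass_ge0.
apply: (@le_trans _ _ (\sum_(jk : J * J | jk.1 != jk.2)
    mass (fun x => (p i x, q i x)) jk * (`|ln off| + 1))).
  apply: ler_sum => -[j k] /= /negbTE jk; rewrite ler_wpM2l ?mass_ge0//.
  by rewrite /c jk add0r -/off ler_wpDr// -normrN ler_norm.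
rewrite -mulr_suml mass_mismatch//.
by rewrite -ler_pdivlMr// ltr_wpDl.
Qed.

End labellings.

(** * Upper limits of extended real sequences *)

Section limn_esup_lemmas.
Context {R : realType}.
Implicit Types u v : nat -> \bar R.
Local Open Scope ereal_scope.

Lemma le_limn_esup u v :
  (\forall n \near \oo, u n <= v n) -> limn_esup u <= limn_esup v.
Proof.
move=> uv; rewrite /limn_esup !limf_esupE; apply: le_ereal_inf_tmp => _ [V Voo <-].
apply: le_trans (_ : ereal_sup (u @` (V `&` [set n | u n <= v n])) <= _).
  by apply: ereal_inf_lbound; eexists => //; exact: filterI.
apply: ge_ereal_sup => _ [n [Vn uvn] <-]; apply: le_trans uvn _.
by apply: ereal_sup_ubound; exists n.
Qed.

Lemma limn_esupDr_le u (c : R) :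
  limn_esup (fun n => u n + c%:E) <= limn_esup u + c%:E.
Proof.
rewrite -leeBlDr// /limn_esup !limf_esupE; apply: le_ereal_inf_tmp => _ [V Voo <-].
rewrite leeBlDr//; apply: ereal_inf_le.
eexists; first by exists V.
apply: ge_ereal_sup => _ [n Vn <-]; rewrite leeD2r//.
by apply: ereal_sup_ubound; exists n.
Qed.

Lemma limn_esupZl_le u (c : R) : (0 < c)%R ->
  limn_esup (fun n => c%:E * u n) <= c%:E * limn_esup u.
Proof.
move=> c0.
rewrite -lee_pdivrMl// /limn_esup !limf_esupE; apply: le_ereal_inf_tmp => _ [V Voo <-].
rewrite lee_pdivrMl//; apply: ereal_inf_le.
eexists; first by exists V.
apply: ge_ereal_sup => _ [n Vn <-]; rewrite lee_wpmul2l ?lee_fin ?(ltW c0)//.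
by apply: ereal_sup_ubound; exists n.
Qed.

Lemma limn_esup_shift_le u N : limn_esup (fun n => u (n + N)%N) <= limn_esup u.
Proof.
rewrite /limn_esup !limf_esupE; apply: le_ereal_inf_tmp => _ [V [M _ MV] <-].
apply: le_trans (_ : ereal_sup ((fun n => u (n + N)%N) @` [set n | (M <= n)%N]) <= _).
  by apply: ereal_inf_lbound; eexists => //; exists M.
apply: ge_ereal_sup => _ [n /= Mn <-].
by apply: ereal_sup_ubound; exists (n + N)%N => //; apply: MV; exact/leq_trans/leq_addr.
Qed.

End limn_esup_lemmas.

(** * Continuity of the entropy of a partition *)

Section entropy_continuity.
Context {R : realType} (X : pmetricType R) (F : X -> X).
Variable mu : probability (borel X) R.
Hypothesis mF : measurable_fun [set: borel X] (F : borel X -> borel X).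
Hypothesis invF : invariant_measure F mu.

Lemma measurable_iter n : measurable_fun [set: borel X] (iter n F : borel X -> borel X).
Proof.
elim: n => [|n IH]; first exact: measurable_id.
exact: (@measurableT_comp _ _ _ _ _ _ (F : borel X -> borel X)).
Qed.

Lemma invariant_iter n (A : set (borel X)) : measurable A ->
  mu (iter n F @^-1` A) = mu A.
Proof.
move=> mA; elim: n => // n IH.
rewrite (_ : iter n.+1 F @^-1` A = F @^-1` (iter n F @^-1` A)).
  by rewrite invF// -[X in measurable X]setTI; exact: measurable_iter.
by apply/seteqP; split => x; rewrite /= -iterS iterSr.
Qed.

(** Invariance gives all the letters of the two itineraries the same probability
    of mismatch, hence an error of at most [eps] per letter. *)
Lemma entropy_wrt_close k (p : X -> 'I_k) (eps : R) :
  measurable_labelling (p : borel X -> _) -> 0 < eps ->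
  exists2 eta : R, 0 < eta &
    forall q : X -> 'I_k, measurable_labelling (q : borel X -> _) ->
    fine (mu [set x | p x != q x]) <= eta ->
    (entropy_wrt F mu p <= entropy_wrt F mu q + eps%:E)%E.
Proof.
move=> mp eps0.
have miter (r : X -> 'I_k) i : measurable_labelling (r : borel X -> _) ->
    measurable_labelling (r \o iter i F : borel X -> _).
  by move=> mr j; rewrite -[X in measurable X]setTI; exact: measurable_iter (mr j).
have [eta eta0 close] := shannon_close mu 'I_k eps0.
exists eta => // q mq pq.
apply: le_trans (limn_esupDr_le _ _); apply: le_limn_esup.
(* At n = 0 the quotient by n is 0 by convention. *)
exists 1%N => // n /= n1; rewrite -EFinD lee_fin.
rewrite ler_pdivrMr ?ltr0n// mulrDl divfK ?pnatr_eq0 ?lt0n_neq0// [eps * _]mulrC.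
apply: (close n (fun i => p \o iter i F) (fun i => q \o iter i F)) => [i|i|i].
- exact: miter.
- exact: miter.
- rewrite (_ : [set x | _] = iter i F @^-1` [set x | p x != q x])// invariant_iter//.
  have := @labelling_preimage _ _ _ _ [set jk | jk.1 != jk.2] (labelling_pair mp mq).
  by [].
Qed.
End entropy_continuity.

(** * Approximation by an algebra of sets *)

Lemma measure_bigsetU_le d (X : measurableType d) (R : realType)
    (mu : probability X R) (I : finType) (A : I -> set X) :
  (forall i, measurable (A i)) ->
  (mu (\big[setU/set0]_i A i) <= \sum_i mu (A i))%E.
Proof.
move=> mA.
suff [] : measurable (\big[setU/set0]_i A i) /\
  (mu (\big[setU/set0]_i A i) <= \sum_i mu (A i))%E by [].
elim/big_rec2: _ => [|i s B _ [mB muB]]; first by rewrite measure0.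
split; first exact: measurableU.
by apply: le_trans (measureU2 _ (mA i) mB) _; exact: leeD2l.
Qed.

Section algebra_approximation.
Context d (X : measurableType d) (R : realType) (mu : probability X R).
Local Open Scope ereal_scope.

Lemma mu_setY_sub (A B D : set X) : measurable A -> measurable B -> measurable D ->
  A `+` B `<=` D -> mu (A `+` B) <= mu D.
Proof.
move=> mA mB mD ABD; apply: le_measure; rewrite ?inE//.
by apply: measurableU; exact: measurableD.
Qed.

Variable C : set (set X).
Hypothesis mC : C `<=` measurable.
Hypothesis C0 : C set0.
Hypothesis CC : forall A, C A -> C (~` A).
Hypothesis CU : forall A B, C A -> C B -> C (A `|` B).

Let approx := [set A | measurable A /\
  forall eps : R, (0 < eps)%R -> exists2 B, C B & mu (A `+` B) < eps%:E].

Let approxC A : approx A -> approx (~` A).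
Proof.
move=> [mA hA]; split; first exact: measurableC.
move=> e e0; have [B CB muB] := hA _ e0; exists (~` B); first exact: CC.
rewrite (_ : _ `+` _ = A `+` B)// /setY !setDE !setCK setUC.
by rewrite [B `&` _]setIC [~` B `&` A]setIC setUC.
Qed.

Let approxU A B : approx A -> approx B -> approx (A `|` B).
Proof.
move=> [mA hA] [mB hB]; split; first exact: measurableU.
move=> e e0; have e20 : (0 < e / 2)%R by rewrite divr_gt0.
have [A' CA' muA] := hA _ e20; have [B' CB' muB] := hB _ e20.
have [mA' mB'] := (mC CA', mC CB').
have mAA : measurable (A `+` A') by apply: measurableU; exact: measurableD.
have mBB : measurable (B `+` B') by apply: measurableU; exact: measurableD.
exists (A' `|` B'); first exact: CU.
apply: (@le_lt_trans _ _ (mu ((A `+` A') `|` (B `+` B')))).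
  apply: mu_setY_sub; [exact: measurableU..|].
  by move=> x /=; tauto.
apply: le_lt_trans (measureU2 _ _ _) _ => //.
by rewrite (splitr e) EFinD lteD.
Qed.

Let approx_bigcup (A : (set X)^nat) : (forall n, approx (A n)) ->
  approx (\bigcup_n A n).
Proof.
move=> hA; have mA n : measurable (A n) by have [] := hA n.
have mUA : measurable (\bigcup_n A n) by exact: bigcupT_measurable.
split => // e e0; have e20 : (0 < e / 2)%R by rewrite divr_gt0.
pose S n := \big[setU/set0]_(k < n) A k.
have hS n : approx (S n).
  rewrite /S; elim: n => [|n IH]; last by rewrite big_ord_recr; exact: approxU.
  rewrite big_ord0; split => // e' e'0; exists set0 => //.
  by rewrite setYK measure0 lte_fin.
have mS n : measurable (S n) by have [] := hS n.
have SA n : S n `<=` \bigcup_k A k.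
  by rewrite /S -bigcup_mkord => x [k _ Akx]; exists k.
have [n muD] : exists n, mu (\bigcup_k A k `\` S n) < (e / 2)%:E.
  have : mu \o (fun n => \bigcup_k A k `\` S n) @ \oo -->
      mu (\bigcap_n (\bigcup_k A k `\` S n)).
    apply: nonincreasing_cvg_mu => //.
    - by rewrite -ge0_fin_numE// fin_num_measure//; exact: measurableD.
    - by move=> n; exact: measurableD.
    - by apply: bigcapT_measurable => n; exact: measurableD.
    - move=> m n mn; apply/subsetPset; apply: setDS.
      rewrite /S -!bigcup_mkord => x [k /= km Akx]; exists k => //=.
      exact: leq_trans mn.
  rewrite [X in mu X](_ : _ = set0); last first.
    apply/seteqP; split => // x Dx; have [[k _ Akx] _] := Dx 0%N I.
    have [_] := Dx k.+1 I; apply; rewrite /S -bigcup_mkord; exists k => //=.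
  rewrite measure0 => /fine_cvgP[_ /cvgrPdist_lt/(_ _ e20)[n _ /(_ n)]].
  rewrite /= leqnn sub0r normrN => /(_ isT) h; exists n.
  rewrite -[ltLHS]fineK ?fin_num_measure//; last exact: measurableD.
  by rewrite lte_fin; exact: le_lt_trans (ler_norm _) h.
have [B CB muB] := (hS n).2 _ e20.
have mB := mC CB.
have mSB : measurable (S n `+` B) by apply: measurableU; exact: measurableD.
have mD : measurable (\bigcup_k A k `\` S n) by exact: measurableD.
exists B => //.
apply: (@le_lt_trans _ _ (mu ((\bigcup_k A k `\` S n) `|` (S n `+` B)))).
  apply: mu_setY_sub => //; first exact: measurableU.
  move=> x /=; have /= := @SA n x; have [] := pselect (S n x); tauto.
apply: le_lt_trans (measureU2 _ _ _) _ => //.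
by rewrite (splitr e) EFinD lteD.
Qed.

(** The sets that can be approximated in measure by the algebra form a
    sigma-algebra: a countable union is approximated by its finite subunions
    because the measure is finite. *)
Lemma algebra_approx (A : set X) (eps : R) : <<s C >> A -> (0 < eps)%R ->
  exists2 B, C B & mu (A `+` B) < eps%:E.
Proof.
move=> CA; suff [_] : approx A by apply.
apply: CA; split; last first.
  move=> B CB; split; first exact: mC.
  by move=> e e0; exists B => //; rewrite setYK measure0.
split; last exact: approx_bigcup.
  by split => // e e0; exists set0 => //; rewrite setYK measure0.
by move=> B; rewrite setTD; exact: approxC.
Qed.

End algebra_approximation.

(** * Borel measurability of continuous maps *)

Section borel_maps.

Lemma borel_open (X : ptopologicalType) (O : set X) :
  open O -> measurable (O : set (borel X)).
Proof. exact: sub_sigma_algebra. Qed.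

Lemma borel_continuous (X Y : ptopologicalType) (h : X -> Y) :
  continuous h -> measurable_fun [set: borel X] (h : borel X -> borel Y).
Proof.
move=> /(continuousP h) ch; apply: (@measurability _ _ _ (borel Y) _ _ (@open Y)) => //.
by move=> _ [U oU <-]; rewrite setTI; apply: borel_open; exact: ch.
Qed.

Lemma borel_continuous_real (R : realType) (X : ptopologicalType) (h : X -> R) :
  continuous h -> measurable_fun [set: borel X] (h : borel X -> R).
Proof.
move=> /(continuousP h) ch; apply: (measurability _ (RGenOpens.measurableE R)).
move=> _ [_ [a [b ->] <-]]; rewrite setTI; apply: borel_open.
exact/ch/interval_open.
Qed.

End borel_maps.

(** * Coordinates and topology of the inverse limit *)

Section inverse_limit_geometry.
Context {R : realType} {T : normedModType R} {V : set T} {f : T -> T}.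
Variable L : basic_set V f.
Local Notation X := (invlim L).
Local Notation g := (basic_map L).
Local Notation F := (invlim_map L).
Implicit Types x y : X.

Lemma coord_pred x i : g (invlim_coord x i.+1) = invlim_coord x i.
Proof. exact: set_valP x i. Qed.

Lemma coord_map x i : invlim_coord (F x) i = g (invlim_coord x i).
Proof. by case: i => // i; rewrite coord_pred. Qed.

Lemma coord_iter n x i : invlim_coord (iter n F x) i = iter n g (invlim_coord x i).
Proof. by elim: n => //= n IH; rewrite coord_map IH. Qed.

Lemma iter_coord n x i : iter n g (invlim_coord x (n + i)) = invlim_coord x i.
Proof. by elim: n => // n IH; rewrite iterSr addSn coord_pred. Qed.

Lemma iter_coord_sub i n x : (i <= n)%N ->
  iter (n - i) g (invlim_coord x n) = invlim_coord x i.
Proof. by move=> i_n; rewrite -{2}(subnK i_n) iter_coord. Qed.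

(** After [n] steps the present state has moved to position [-n]; by invariance
    all coordinates therefore have the same law. *)
Lemma coord_iterK n x : invlim_coord (iter n F x) n = invlim_coord x 0.
Proof. by rewrite coord_iter -[RHS](iter_coord n) addn0. Qed.

Lemma invlim_proj_surj (z : basic_type L) : exists x, invlim_proj L x = z.
Proof.
pose h i := iter i (fun z => sval (cid (basic_map_surj z))) z.
have hP : h \in [set x : nat -> basic_type L | forall i, g (x i.+1) = x i].
  by apply/mem_set => i; rewrite /h/=; case: cid.
by exists (SigSub hP).
Qed.

Lemma coord_surj n (z : basic_type L) : exists x, invlim_coord x n = z.
Proof.
by have [x xz] := invlim_proj_surj z; exists (iter n F x); rewrite coord_iterK.
Qed.

Lemma mdist_coord_le x y i :
  mdist (invlim_coord x i) (invlim_coord y i) <= 2 ^+ i * mdist x y.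
Proof.
rewrite mulrC -ler_pdivrMr ?exprn_gt0//.
pose u k : R := mdist (invlim_coord x k) (invlim_coord y k) / 2 ^+ k.
have u0 k : 0 <= u k by rewrite divr_ge0// mdist_ge0.
have nd : nondecreasing_seq (series u).
  by apply/nondecreasing_seqP => n; rewrite /series/= big_nat_recr//= lerDl.
apply: (le_trans _ (nondecreasing_cvgn_le nd (is_cvg_invlim_dist x y) i.+1)).
by rewrite /series/= big_nat_recr//= lerDr sumr_ge0.
Qed.

Lemma sum_expV2_le n : \sum_(i < n) (2^-1 : R) ^+ i <= 2.
Proof.
rewrite (_ : \sum_(i < n) _ = 2 - 2 * 2^-1 ^+ n) ?gerBl ?mulr_ge0 ?exprn_ge0//.
elim: n => [|n IH]; first by rewrite big_ord0 expr0; lra.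
by rewrite big_ord_recr/= IH exprS; lra.
Qed.

(** The coordinates from [N] on contribute at most the bound [M] times the tail
    of the weights, and the others at most [d] times their total sum. *)
Lemma mdist_invlim_le (M d : R) x y N :
  (forall u v : basic_type L, mdist u v <= M) -> 0 <= d ->
  (forall i, (i < N)%N -> mdist (invlim_coord x i) (invlim_coord y i) <= d) ->
  mdist x y <= 2 * d + 2 * M * 2^-1 ^+ N.
Proof.
move=> ubM d0 xyd.
have M0 : 0 <= M by apply: le_trans (ubM point point); exact: mdist_ge0.
apply: (limr_le (is_cvg_invlim_dist x y)); apply: nearW => n.
rewrite /series/= big_mkord.
pose u k : R := mdist (invlim_coord x k) (invlim_coord y k) / 2 ^+ k.
have u0 k : 0 <= u k by rewrite divr_ge0// mdist_ge0.
apply: (@le_trans _ _ (\sum_(i < N + n) u i)).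
  by rewrite addnC big_split_ord/= lerDl sumr_ge0.
rewrite big_split_ord/=; apply: lerD.
  apply: (@le_trans _ _ (\sum_(i < N) d * 2^-1 ^+ i)).
    apply: ler_sum => i _; rewrite /u exprVn ler_wpM2r ?invr_ge0 ?exprn_ge0//.
    exact: xyd.
  by rewrite -mulr_sumr mulrC ler_wpM2r// sum_expV2_le.
apply: (@le_trans _ _ (\sum_(i < n) M * 2^-1 ^+ N * 2^-1 ^+ i)).
  apply: ler_sum => i _; rewrite /u -mulrA -exprD exprVn.
  by rewrite ler_wpM2r ?invr_ge0 ?exprn_ge0.
rewrite -mulr_sumr mulrC -[leRHS]mulrA ler_wpM2r ?sum_expV2_le//.
by rewrite mulr_ge0// exprn_ge0.
Qed.

Lemma expV2_small (M e : R) : 0 < e -> exists N, M * 2^-1 ^+ N < e.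
Proof.
move=> e0.
have : (fun n => M * 2^-1 ^+ n) @ \oo --> (0 : R).
  rewrite -[X in _ --> X](mulr0 M); apply: cvgMl_tmp.
  by apply: cvg_expr; rewrite ger0_norm ?invr_ge0// invf_lt1// ltr1n.
move=> /cvgrPdist_lt/(_ _ e0)[N _ /(_ N)]/=; rewrite leqnn sub0r normrN => /(_ isT) h.
by exists N; exact: le_lt_trans (ler_norm _) h.
Qed.

Lemma coord_continuous i : continuous (fun x : X => invlim_coord x i).
Proof.
move=> x; apply: (iffRL (@cvg_ballP _ _ _ (nbhs x) (nbhs_filter x) _ _)) => e e0.
have : \forall y \near x, ball x (e / 2 ^+ i) y.
  by apply: nbhsx_ballx; rewrite divr_gt0 ?exprn_gt0.
apply: filterS => y; rewrite !ballEmdist/= ltr_pdivlMr ?exprn_gt0// mulrC.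
exact/le_lt_trans/mdist_coord_le.
Qed.

Hypothesis cg : continuous g.

Lemma iter_continuous n : continuous (iter n g).
Proof.
elim: n => [|n IH] x; first exact: cvg_id.
by apply: (@continuous_comp _ _ _ (iter n g) g x); [exact: IH|exact: cg].
Qed.

(** Closeness of [x_{-N}] and [y_{-N}] propagates to the coordinates of index
    less than [N] by continuity of [g], and the other ones weigh little: a
    small enough neighbourhood of a single remote coordinate pulls back into a
    given ball. *)
Lemma invlim_open_cylinders (O : set X) : open O ->
  exists2 B : (set (basic_type L))^nat, (forall n, open (B n)) &
    O = \bigcup_n ((fun x => invlim_coord x n) @^-1` B n).
Proof.
move=> oO.
(* Taking all the admissible open sets at once avoids any countability
   assumption. *)
exists (fun n => \bigcup_(B in [set B | open B /\
   (fun x => invlim_coord x n) @^-1` B `<=` O]) B).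
  by move=> n; apply: bigcup_open => B [].
apply/seteqP; split => [x Ox|x [n _ [B [_ BO] Bx]]]; last exact: BO.
have [e /= e0 xeO] : nbhs_ball x O by rewrite nbhs_ballE; apply: open_nbhs_nbhs; split.
have [M ubM] := basic_dist_bounded L.
have e40 : 0 < e / 4 by rewrite divr_gt0.
(* The bound of [mdist_invlim_le] is then below 2 * (e / 4) + e / 4. *)
have [N NM] := expV2_small (2 * M) e40.
pose near_coords z := forall i : 'I_N,
  mdist (invlim_coord x i) (iter (N - i) g z) < e / 4.
exists N => //; exists near_coords^°; last first.
  apply: (@filter_forall _ _ (fun (i : 'I_N) z =>
    mdist (invlim_coord x i) (iter (N - i) g z) < e / 4) _ (nbhs_filter _)) => i.
  have /cvg_ballP/(_ _ e40) := @iter_continuous (N - i) (invlim_coord x N).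
  by apply: filterS => z; rewrite ballEmdist/= iter_coord_sub// ltnW.
split; first exact: open_interior.
move=> y /interior_subset yx; apply: xeO; rewrite ballEmdist/=.
apply: (le_lt_trans (@mdist_invlim_le M (e / 4) x y N ubM (ltW e40) _)); last lra.
move=> i iN; apply: ltW; rewrite -(iter_coord_sub y (ltnW iN)).
exact: yx (Ordinal iN).
Qed.

Lemma invlim_map_continuous : continuous F.
Proof.
apply/continuousP => O /invlim_open_cylinders[B oB ->].
rewrite preimage_bigcup; apply: bigcup_open => n _.
rewrite -comp_preimage (_ : _ \o F = g \o (fun x => invlim_coord x n)); last first.
  by apply/funext => x; exact: coord_map.
have /continuousP : continuous (g \o (fun x : X => invlim_coord x n)).
  by move=> x; apply: continuous_comp; [exact: coord_continuous|exact: cg].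
exact.
Qed.

End inverse_limit_geometry.

(** * Topological entropy of the inverse limit *)

Section topological_entropy_factor.
Context {R : realType}.
Local Open Scope ereal_scope.

Lemma ln_span_ge0 (X : pmetricType R) (F : X -> X) n e : 0 <= ln_span F n e.
Proof.
apply: le_ereal_inf_tmp => _ [s sF <-].
have [y ys _] := sF point.
by rewrite lee_fin ln_ge0// ler1n; case: s ys {sF}.
Qed.

(** For [r < 1], [r * (n + N) <= n] as soon as [n] is large. *)
Lemma limn_esup_rate_shift (a : nat -> \bar R) N : (forall n, 0 <= a n) ->
  limn_esup (fun n => n%:R^-1%:E * a (n + N)%N) <=
  limn_esup (fun n => n%:R^-1%:E * a n).
Proof.
move=> a0; apply/lee_mul01Pr.
  apply: limf_esup_ge0 => [[n _ /(_ n)]|n]; first by apply => /=.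
  by rewrite mule_ge0// lee_fin invr_ge0.
move=> r /andP[r0 r1]; rewrite -lee_pdivlMl//.
apply: le_trans (limn_esupZl_le _ _); last by rewrite invr_gt0.
apply: le_trans (limn_esup_shift_le _ N).
apply: le_limn_esup.
have := nbhs_infty_ger (r * N%:R / (1 - r)).
move: (nbhs_infty_gt 0); apply: filterS2 => n n0 rn.
rewrite muleA lee_wpmul2r// -EFinM lee_fin -invfM lef_pV2 ?posrE
  ?mulr_gt0 ?ltr0n ?addn_gt0 ?n0//.
by move: rn; rewrite ler_pdivrMr ?subr_gt0// natrD; lra.
Qed.

(** A spanning set of the extension maps onto a spanning set of the factor. *)
Lemma topological_entropy_factor (X Y : pmetricType R) (F : X -> X) (G : Y -> Y)
    (h : X -> Y) :
  (forall y, exists x, h x = y) -> (forall x, h (F x) = G (h x)) ->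
  (forall x y, (mdist (h x) (h y) <= mdist x y)%R) ->
  topological_entropy G <= topological_entropy F.
Proof.
move=> surj hF lip.
have hiter i x : h (iter i F x) = iter i G (h x).
  by elim: i => //= i IH; rewrite hF IH.
apply: ge_ereal_sup => _ [e e0 <-].
apply: le_trans (_ : limn_esup (fun n => n%:R^-1%:E * ln_span F n e) <= _); last first.
  by apply: ereal_sup_ubound; exists e.
apply: le_limn_esup; apply: nearW => n; rewrite lee_wpmul2l ?lee_fin ?invr_ge0//.
apply: le_ereal_inf => _ [s sF <-]; exists (map h s); last by rewrite size_map.
move=> y; have [x <-] := surj y; have [z zs xz] := sF x.
exists (h z); first exact: map_f.
by move=> i ni; rewrite -!hiter; apply: le_trans (lip _ _) (xz _ ni).
Qed.

End topological_entropy_factor.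

Section inverse_limit_entropy.
Context {R : realType} {T : normedModType R} {V : set T} {f : T -> T}.
Variable L : basic_set V f.
Local Notation X := (invlim L).
Local Notation g := (basic_map L).
Local Notation F := (invlim_map L).
Local Open Scope ereal_scope.

(** The projection is a Lipschitz factor map.  Conversely, choosing for each point
    of a [(n + N)]-spanning set a history that passes through it at time [-N]
    gives an [n]-spanning set of histories, of the same size. *)
Lemma topological_entropy_invlim : topological_entropy F = topological_entropy g.
Proof.
apply/eqP; rewrite eq_le; apply/andP; split; last first.
  apply: (@topological_entropy_factor _ _ _ _ _ (invlim_proj L)).
  - exact: invlim_proj_surj.
  - by move=> x; exact: coord_map.
  - by move=> x y; have := mdist_coord_le x y 0; rewrite expr0 mul1r.
apply: ge_ereal_sup => _ [e /= e0 <-].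
have [M ubM] := basic_dist_bounded L.
(* With d = e / 4 the bound of [mdist_invlim_le] is 2 * d + e / 2 = e. *)
have e20 : (0 < e / 2)%R by rewrite divr_gt0.
have [N NM] := expV2_small (2 * M) e20.
have d0 : (0 < e / 4)%R by rewrite divr_gt0.
apply: le_trans (_ : limn_esup (fun n =>
  n%:R^-1%:E * ln_span g n (e / 4)%R) <= _); last first.
  by apply: ereal_sup_ubound; exists (e / 4)%R.
apply: le_trans (limn_esup_rate_shift N (fun n => ln_span_ge0 g n _)).
apply: le_limn_esup; apply: nearW => n; rewrite lee_wpmul2l ?lee_fin ?invr_ge0//.
pose lift (z : basic_type L) := sval (cid (coord_surj N z)).
have liftK z : invlim_coord (lift z) N = z by rewrite /lift; case: cid.
apply: le_ereal_inf => _ [s sg <-]; exists (map lift s); last by rewrite size_map.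
move=> x; have [z zs xz] := sg (invlim_coord x N).
exists (lift z); first exact: map_f.
move=> j jn.
apply: (le_trans (@mdist_invlim_le _ _ _ _ _ M (e / 4) _ _ N ubM (ltW d0) _)).
  move=> i iN; rewrite !coord_iter -!(iter_coord_sub _ (ltnW iN)) liftK -!iterD.
  by apply: xz; rewrite -addSn leq_add// leq_subr.
by move: NM; lra.
Qed.

End inverse_limit_entropy.

(** * Measure entropy of the inverse limit *)

Section inverse_limit_measure_entropy.
Context {R : realType} {T : normedModType R} {V : set T} {f : T -> T}.
Variable L : basic_set V f.
Local Notation X := (invlim L).
Local Notation Y := (basic_type L).
Local Notation g := (basic_map L).
Local Notation F := (invlim_map L).
Local Notation coord n := (fun x : borel X => invlim_coord (x : X) n : borel Y).
Hypothesis cg : continuous g.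

Lemma measurable_coord n : measurable_fun [set: borel X] (coord n).
Proof. exact: (borel_continuous (@coord_continuous _ _ _ _ L n)). Qed.

Lemma measurable_coord_preimage n (B : set (borel Y)) :
  measurable B -> measurable (coord n @^-1` B).
Proof. by move=> mB; rewrite -[X in measurable X]setTI; exact: measurable_coord. Qed.

Lemma measurable_invlim_map : measurable_fun [set: borel X] (F : borel X -> borel X).
Proof. exact: (borel_continuous (invlim_map_continuous cg)). Qed.

Lemma measurable_basic_iter n :
  measurable_fun [set: borel Y] (iter n g : borel Y -> borel Y).
Proof. exact: (borel_continuous (@iter_continuous _ _ _ _ L cg n)). Qed.

Definition cylinders : set (set (borel X)) :=
  [set A | exists n, exists2 B : set (borel Y), measurable B & A = coord n @^-1` B].

(** A cylinder may be read at any older coordinate, since the older state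
    determines the newer one; hence the cylinders form an algebra. *)
Lemma coord_lift n m (B : set (borel Y)) : (n <= m)%N -> measurable B ->
  exists2 B' : set (borel Y), measurable B' & coord n @^-1` B = coord m @^-1` B'.
Proof.
move=> nm mB; exists (iter (m - n) g @^-1` B).
  by rewrite -[X in measurable X]setTI; exact: measurable_basic_iter.
by apply/seteqP; split => x /=; rewrite iter_coord_sub.
Qed.

Lemma cylinders_measurable : cylinders `<=` measurable.
Proof. by move=> _ [n [B mB ->]]; exact: measurable_coord_preimage. Qed.

Lemma cylindersU A B : cylinders A -> cylinders B -> cylinders (A `|` B).
Proof.
move=> [n [A1 mA1 ->]] [m [B1 mB1 ->]].
have [A2 mA2 ->] := coord_lift (leq_maxl n m) mA1.
have [B2 mB2 ->] := coord_lift (leq_maxr n m) mB1.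
by exists (maxn n m), (A2 `|` B2) => //; exact: measurableU.
Qed.

Lemma borel_cylinders (A : set (borel X)) : measurable A -> <<s cylinders >> A.
Proof.
apply: smallest_sub; first exact: smallest_sigma_algebra.
move=> O /(invlim_open_cylinders cg)[B oB ->].
have [_ _] := smallest_sigma_algebra setT cylinders; apply => n.
by apply: sub_sigma_algebra; exists n, (B n) => //; exact: borel_open.
Qed.

Variable muhat : probability (borel X) R.

Lemma cylinder_approx (A : set (borel X)) (eps : R) : measurable A -> 0 < eps ->
  exists n, exists2 B : set (borel Y), measurable B &
    (muhat (A `+` (coord n @^-1` B)) < eps%:E)%E.
Proof.
move=> /borel_cylinders sA eps0.
have [||||_ [n [B mB ->]] ?] := algebra_approx muhat _ _ _ _ sA eps0.
- exact: cylinders_measurable.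
- by exists 0%N, set0 => //; rewrite preimage_set0.
- by move=> _ [n [B mB ->]]; exists n, (~` B) => //; exact: measurableC.
- exact: cylindersU.
- by exists n, B.
Qed.

(** The blocks are approximated separately, by cylinders read at a common
    coordinate.  These need neither be disjoint nor cover; [q] picks one that
    contains the point, and is right wherever no block differs from its
    cylinder. *)
Lemma labelling_cylinder_approx k (p : borel X -> 'I_k) (eta : R) :
  measurable_labelling p -> 0 < eta ->
  exists n, exists2 q : borel Y -> 'I_k, measurable_labelling q &
    fine (muhat [set x | p x != q (coord n x)]) <= eta.
Proof.
move=> mp eta0.
have k0 : (0 < k)%N by apply: leq_ltn_trans (ltn_ord (p point)).
have etak0 : 0 < eta / k%:R by rewrite divr_gt0 ?ltr0n.
have /choice[n /choice[B nB]] : forall j, exists n, exists B : set (borel Y),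
    measurable B /\ (muhat ((p @^-1` [set j]) `+` (coord n @^-1` B)) < (eta / k%:R)%:E)%E.
  by move=> j; have [n [B ? ?]] := cylinder_approx (mp j) etak0; exists n, B.
pose N := \max_(j < k) n j.
have /choice[D BD] : forall j, exists D : set (borel Y),
    measurable D /\ coord (n j) @^-1` (B j) = coord N @^-1` D.
  move=> j; have nN : (n j <= N)%N by exact: leq_bigmax.
  by have [D ? ?] := coord_lift nN (nB j).1; exists D.
pose h (s : {ffun 'I_k -> bool}) := odflt (p point) [pick j | s j].
pose q (y : borel Y) := h [ffun j => `[< D j y >]].
have mD j : measurable_labelling (fun y : borel Y => `[< D j y >]).
  have mDj := (BD j).1.
  case.
    rewrite (_ : _ @^-1` _ = D j)//.
    by apply/seteqP; split => y /=; [move/asboolP|move=> ?; apply/asboolP].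
  rewrite (_ : _ @^-1` _ = ~` D j); first exact: measurableC.
  by apply/seteqP; split => y /=;
    [move=> /negbT/asboolPn|move=> ?; apply/negbTE/asboolPn].
have mq : measurable_labelling q by exact: (labelling_comp h (labelling_ffun mD)).
exists N, q => //.
have mC j : measurable ((p @^-1` [set j]) `+` (coord N @^-1` D j)).
  have mDj := measurable_coord_preimage N (BD j).1.
  by apply: measurableU; apply: measurableD => //; exact: mp.
have mpq : measurable [set x | p x != q (coord N x)].
  have mqN : measurable_labelling (q \o coord N).
    by move=> j; exact: measurable_coord_preimage (mq j).
  exact: (@labelling_preimage _ _ _ _ [set jk | jk.1 != jk.2] (labelling_pair mp mqN)).
rewrite -lee_fin fineK ?fin_num_measure//.
apply: (@le_trans _ _ (muhat (\big[setU/set0]_(j < k)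
  ((p @^-1` [set j]) `+` (coord N @^-1` D j))))).
  apply: le_measure; rewrite ?inE//; first exact: bigsetU_measurable.
  move=> x /= pq; rewrite -bigcup_seq; apply: contrapT => nx; move/eqP: pq; apply.
  have xD j : `[< D j (coord N x) >] = (p x == j).
    apply/asboolP/eqP => [xDj|xpj]; apply: contrapT => nj; apply: nx; exists j => //=.
    - by rewrite mem_index_enum.
    - by right.
    - by rewrite mem_index_enum.
    - by left.
  rewrite /q /h; case: pickP => [j|/(_ (p x))]; rewrite ffunE xD; first by move=> /eqP.
  by rewrite eqxx.
apply: le_trans (measure_bigsetU_le muhat mC) _.
apply: (@le_trans _ _ (\sum_(j < k) (eta / k%:R)%:E)%E).
  by apply: lee_sum => j _; rewrite -(BD j).2; exact/ltW/(nB j).2.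
rewrite sumEFin sumr_const card_ord lee_fin -[_ *+ k]mulr_natr divfK//.
by rewrite pnatr_eq0 -lt0n.
Qed.

Variable nu : probability (borel Y) R.
Hypothesis inv : invariant_measure F muhat.
Hypothesis nuE : forall A, measurable A -> nu A = muhat (coord 0 @^-1` A).

Lemma coord_law n (A : set (borel Y)) : measurable A ->
  muhat (coord n @^-1` A) = nu A.
Proof.
move=> mA; rewrite nuE// -(invariant_iter measurable_invlim_map inv n).
  by congr (muhat _); apply/seteqP; split => x /=; rewrite coord_iterK.
exact: measurable_coord_preimage.
Qed.

Lemma invariant_proj : invariant_measure g nu.
Proof.
move=> A mA; rewrite nuE; last first.
  rewrite -[X in measurable X]setTI.
  exact: (@measurable_basic_iter 1).
rewrite -(coord_law 0)//.
rewrite -(inv (measurable_coord_preimage 0 mA)).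
by congr (muhat _); apply/seteqP; split => x /=; rewrite coord_map.
Qed.

Lemma entropy_wrt_coord n k (q : Y -> 'I_k) :
  measurable_labelling (q : borel Y -> 'I_k) ->
  entropy_wrt F muhat (q \o (fun x => invlim_coord x n)) = entropy_wrt g nu q.
Proof.
move=> mq; rewrite /entropy_wrt; congr limn_esup; apply/funext => m.
congr ((_ / _)%:E); rewrite /partition_entropy; congr (- _).
have mit : measurable_labelling (itinerary g q m : borel Y -> _).
  apply: labelling_ffun => i j; rewrite -[X in measurable X]setTI.
  exact: measurable_basic_iter (mq j).
apply: eq_bigr => s _; rewrite -(coord_law n (mit s)).
rewrite (_ : itinerary F _ m = itinerary g q m \o (fun x => invlim_coord x n))//.
by apply/funext => x; apply/ffunP => i; rewrite !ffunE /= coord_iter.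
Qed.

(** Partitions of the basic set pull back to partitions of equal entropy, and up
    to an arbitrarily small loss of entropy all partitions of the inverse limit
    arise so, at some coordinate. *)
Lemma measure_entropy_proj : measure_entropy F muhat = measure_entropy g nu.
Proof.
apply/eqP; rewrite eq_le; apply/andP; split.
  apply: ge_ereal_sup => _ [k [p [mp ->]]]; apply/lee_addgt0Pr => e e0.
  have [eta eta0 close] := entropy_wrt_close measurable_invlim_map inv mp e0.
  have [n [q mq pq]] := labelling_cylinder_approx mp eta0.
  have mqn : measurable_labelling (q \o coord n).
    by move=> j; exact: measurable_coord_preimage (mq j).
  apply: le_trans (close _ mqn pq) _.
  rewrite (entropy_wrt_coord n mq) leeD2r//; apply: ereal_sup_ubound.
  by exists k, q.
apply: ge_ereal_sup => _ [k [q [mq ->]]].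
rewrite -(entropy_wrt_coord 0 mq); apply: ereal_sup_ubound.
exists k; eexists; split; last reflexivity.
by move=> j; exact: measurable_coord_preimage (mq j).
Qed.

End inverse_limit_measure_entropy.

(** * Discounted sums and their integrals *)

Section discounted_integral.
Context {R : realType} (X : pmetricType R) (F : X -> X).
Variable mu : probability (borel X) R.
Hypothesis mF : measurable_fun [set: borel X] (F : borel X -> borel X).
Hypothesis invF : invariant_measure F mu.

Lemma bounded_integrable (h : borel X -> R) (M : R) :
  measurable_fun [set: borel X] h -> (forall x, `|h x| <= M) ->
  mu.-integrable [set: borel X] (EFin \o h).
Proof.
move=> mh hM; apply: measurable_bounded_integrable => //.
  by apply: le_lt_trans (probability_le1 mu measurableT) _; rewrite ltry.
by exists M; split; [exact: num_real|move=> r Mr x _; exact: le_trans (hM x) (ltW Mr)].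
Qed.

Lemma integral_invariant (h : borel X -> R) (M : R) :
  measurable_fun [set: borel X] h -> (forall x, `|h x| <= M) ->
  (\int[mu]_x (h (F x))%:E = \int[mu]_x (h x)%:E)%E.
Proof.
move=> mh hM.
have mhF : measurable_fun [set: borel X] (h \o F : borel X -> R).
  exact: measurableT_comp.
pose FF := MeasurableFun.Pack (MeasurableFun.Class
  (isMeasurableFun.Build _ _ _ _ (F : borel X -> borel X) mF)).
have -> : (\int[mu]_x (h x)%:E = \int[distribution mu FF]_x (h x)%:E)%E.
  by apply: eq_measure_integral => A mA _; rewrite -[LHS]invF.
rewrite integral_distribution//; first exact/measurable_EFinP.
by apply: (@bounded_integrable _ M mhF) => x; exact: hM.
Qed.

(** Integrating the functional equation makes [int W] the solution of
    [a = int v + beta * a], which determines it because [int W] is finite. *)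
Lemma integral_discounted (W v : borel X -> R) (beta M : R) :
  measurable_fun [set: borel X] W -> measurable_fun [set: borel X] v ->
  (forall x, `|W x| <= M) -> (forall x, `|v x| <= M) -> beta < 1 ->
  (forall x, W (F x) = v (F x) + beta * W x) ->
  (\int[mu]_x (W x)%:E = ((1 - beta)^-1)%:E * \int[mu]_x (v x)%:E)%E.
Proof.
move=> mW mv WM vM beta1 WF.
have iW := bounded_integrable mW WM; have iv := bounded_integrable mv vM.
have mvF : measurable_fun [set: borel X] (v \o F : borel X -> R).
  exact: measurableT_comp.
have ivF : mu.-integrable [set: borel X] (EFin \o (v \o F)).
  by apply: (@bounded_integrable _ M mvF) => x; exact: vM.
have : (\int[mu]_x (W x)%:E = \int[mu]_x (v x)%:E + beta%:E * \int[mu]_x (W x)%:E)%E.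
  rewrite -{1}(integral_invariant mW WM) -(integral_invariant mv vM).
  under eq_integral do rewrite WF EFinD EFinM.
  by rewrite integralD//= ?integralZl//; exact: integrableZl.
have /fineK <- := integrable_fin_num measurableT iW.
have /fineK <- := integrable_fin_num measurableT iv.
rewrite -!EFinM -EFinD => -[eW]; congr (_%:E).
have b1 : 1 - beta != 0 by rewrite subr_eq0 gt_eqF.
by apply: (mulfI b1); rewrite mulVKf// mulrBl mul1r {1}eW addrK.
Qed.

End discounted_integral.

Section discounted_sum.
Context {R : realType} {T : normedModType R} {V : set T} {f : T -> T}.
Variable L : basic_set V f.
Local Notation X := (invlim L).
Local Notation Y := (basic_type L).
Variables (u : Y -> R) (M beta : R).
Hypothesis beta01 : 0 < beta < 1.
Hypothesis uM : forall y, `|u y| <= M.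

Let beta0 : 0 < beta. Proof. by case/andP: beta01. Qed.
Let beta1 : beta < 1. Proof. by case/andP: beta01. Qed.

Let term (x : X) i := beta ^+ i * u (invlim_coord x i).

Let norm_term x i : `|term x i| <= M * beta ^+ i.
Proof.
by rewrite normrM normrX (gtr0_norm beta0) mulrC ler_wpM2r ?exprn_ge0// ltW.
Qed.

Let M0 : 0 <= M. Proof. exact: le_trans (uM point). Qed.

Let cvg_geo : series (geometric M beta) @ \oo --> M / (1 - beta).
Proof. by apply: cvg_geometric_series; rewrite gtr0_norm. Qed.

Let is_cvg_norm x : cvgn [normed series (term x)].
Proof.
apply: (@series_le_cvg _ _ (geometric M beta)) => [i|i|i|].
- exact: normr_ge0.
- by rewrite /= mulr_ge0// exprn_ge0// ltW.
- exact: norm_term.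
- by apply/cvg_ex; eexists; exact: cvg_geo.
Qed.

Lemma is_cvg_discounted x : cvgn (series (fun i => beta ^+ i * u (invlim_coord x i))).
Proof. exact: (@normed_cvg R R^o (term x) (@is_cvg_norm x)). Qed.

Definition discounted x := limn (series (fun i => beta ^+ i * u (invlim_coord x i))).

Lemma discounted_bounded x : `|discounted x| <= M / (1 - beta).
Proof.
apply: le_trans (lim_series_norm (@is_cvg_norm x)) _.
rewrite -(cvg_lim _ cvg_geo)//; apply: lim_series_le.
- exact: is_cvg_norm.
- by apply/cvg_ex; eexists; exact: cvg_geo.
- exact: norm_term.
Qed.

(** The history of [F x] is that of [x] preceded by one new state, so all the
    old discount exponents increase by one. *)
Lemma discounted_map x : discounted (invlim_map L x) =
  u (invlim_proj L (invlim_map L x)) + beta * discounted x.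
Proof.
apply: cvg_lim => //; rewrite -cvg_shiftS.
(* The partial sum of order n + 1 at F x is the new term plus beta times the
   partial sum of order n at x. *)
rewrite (_ : [sequence _]_n = (fun n => u (invlim_proj L (invlim_map L x)) +
    beta * series (term x) n)); last first.
  apply/funext => n; rewrite /series/= big_nat_recl//= expr0 mul1r; congr (_ + _).
  by rewrite mulr_sumr; apply: eq_bigr => i _; rewrite /term mulrA -exprS.
apply: cvgD; first exact: cvg_cst.
by apply: cvgMl_tmp; exact: is_cvg_discounted.
Qed.

Lemma measurable_discounted :
  measurable_fun [set: borel Y] (u : borel Y -> R) ->
  measurable_fun [set: borel X] (discounted : borel X -> R).
Proof.
move=> mu_u.
apply: (@measurable_fun_cvg _ (borel X) R setT
  (fun n (x : borel X) => series (term x) n) discounted); last first.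
  by move=> x _; exact: is_cvg_discounted.
move=> n; rewrite /series /=; apply: measurable_sum => i.
apply: measurable_funM => //.
apply: (@measurableT_comp _ _ _ (borel X) (borel Y) R u setT
  (fun x : borel X => invlim_coord (x : X) i) mu_u); exact: measurable_coord.
Qed.

End discounted_sum.

(** * Regularity of the utility and of the dynamics *)

Section utility_regularity.
Context {R : realType}.

Lemma powR_continuous (a x : R) : 0 < x -> {for x, continuous (@powR R ^~ a)}.
Proof.
move=> x0; apply: differentiable_continuous; apply/derivable1_diffP.
by apply: derivable_powR; rewrite in_itv/= x0.
Qed.

(** The domain keeps all bases of the powers positive: on the line,
    [2 - min 1 x] is at least 1. *)
Lemma utility_continuous (sigma gamma : R) m p : utility_domain m p ->
  {for p, continuous (utility sigma gamma m)}.
Proof.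
have divc (S : topologicalType) (q : S) (h : S -> R) (a c : R) : 0 < h q ->
    {for q, continuous h} -> {for q, continuous (fun x => h x `^ a / c)}.
  move=> hq ch; apply: cvgMr_tmp.
  exact: (@continuous_comp _ _ _ h (@powR R ^~ a) q ch (powR_continuous hq)).
case: m p => /= p.
  move=> p0; have cmin : {for p, continuous (fun x : R => Num.min 1 x)}.
    by apply: continuous_min; [exact: cvg_cst|exact: cvg_id].
  apply: cvgD.
    by apply: divc => //; rewrite lt_min ltr01.
  apply: (divc _ _ (fun x : R => 2 - Num.min 1 x)).
    by rewrite subr_gt0 gt_min ltr1n.
  by apply: cvgB => //; exact: cvg_cst.
move=> [/andP[p10 _] /andP[p20 _]]; apply: cvgD.
- by apply: (divc _ _ fst) => //; exact: cvg_fst.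
- by apply: (divc _ _ snd) => //; exact: cvg_snd.
Qed.

End utility_regularity.

Lemma basic_map_continuous (R : realType) (T : normedModType R) (V : set T)
    (f : T -> T) (L : basic_set V f) :
  open V -> {within V, continuous f} -> continuous (basic_map L).
Proof.
move=> oV; rewrite continuous_open_subspace// => cf x.
have LV y : (L : set T) y -> V y.
  by have [V' [_ LV' V'V _]] := basic_isolated L; move=> /LV'/V'V.
have cx : {for x, continuous (f \o (set_val : basic_type L -> T))}.
  apply: (@continuous_comp _ _ _ (set_val : basic_type L -> T) f x).
    exact: initial_continuous.
  by apply: cf; apply/mem_set/LV; exact: set_valP.
apply: (iffRL (@cvg_ballP _ _ _ (nbhs x) (nbhs_filter x) _ _)) => e e0.
have := iffLR (@cvg_ballP _ _ _ (nbhs x) (nbhs_filter x) _ _) cx e e0.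
by apply: filterS => y; rewrite ballEmdist -ball_normE.
Qed.

(** * The integral of the total utility and the measure of maximal entropy *)

Section utility_integral.
Context {R : realType} (m : ambient) {V : set (phase R m)}
  {f : phase R m -> phase R m}.
Variables (L : basic_set V f) (sigma gamma : R).
Hypothesis LU : (L : set (phase R m)) `<=` utility_domain m.
Local Notation u := (fun y : basic_type L => utility sigma gamma m (set_val y)).

Lemma utility_bounded : exists M, forall y, `|u y| <= M.
Proof.
have cU : {within (L : set (phase R m)), continuous (utility sigma gamma m)}.
  apply: continuous_in_subspaceT => p /set_mem Lp.
  exact/utility_continuous/LU.
have [M [_ MU]] := compact_bounded (continuous_compact cU (basic_compact L)).
exists (M + 1) => y; apply: MU; rewrite ?ltrDl//.
by exists (set_val y) => //; exact: set_valP.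
Qed.

Lemma measurable_utility :
  measurable_fun [set: borel (basic_type L)] (u : borel (basic_type L) -> R).
Proof.
apply: (@borel_continuous_real R (basic_type L) u) => y.
apply: (@continuous_comp _ _ _ (set_val : basic_type L -> phase R m)
  (utility sigma gamma m) y); first exact: initial_continuous.
exact/utility_continuous/LU/set_valP.
Qed.

Lemma integral_total_utility (beta : R)
    (muhat : probability (borel (invlim L)) R) :
  continuous (basic_map L) -> 0 < beta < 1 ->
  invariant_measure (invlim_map L) muhat ->
  (\int[muhat]_x (total_utility beta (utility sigma gamma m) (x : invlim L))%:E =
   ((1 - beta)^-1)%:E *
   \int[muhat]_x (u (invlim_proj L x))%:E)%E.
Proof.
move=> cg beta01 inv; have [M uM] := utility_bounded.
have [b0 b1] := andP beta01.
apply: (@integral_discounted R (invlim L) (invlim_map L) muhat _ inv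
  (discounted u beta) (u \o invlim_proj L) beta (M / (1 - beta))) => //.
- exact: measurable_invlim_map.
- by apply: measurable_discounted => //; exact: measurable_utility.
- exact: (measurableT_comp measurable_utility (measurable_coord 0)).
- by move=> x; exact: discounted_bounded.
- move=> x; apply: le_trans (uM _) _; rewrite ler_pdivlMr ?subr_gt0//.
  have := le_trans (normr_ge0 _) (uM point); nra.
- by move=> x; exact: discounted_map.
Qed.

End utility_integral.

Theorem theorem2 (R : realType) (m : ambient) (V : set (phase R m))
    (f : phase R m -> phase R m) (L : basic_set V f) (beta sigma gamma : R) :
  open V -> {within V, continuous f} -> ~ {in V &, injective f} ->
  0 < beta < 1 -> 0 < sigma -> 0 < gamma -> sigma <> 1 -> gamma <> 1 ->
  (L : set (phase R m)) `<=` utility_domain m ->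
  let U := fun x : borel (basic_type L) =>
    (utility sigma gamma m (set_val (x : basic_type L)))%:E in
  let W := fun x : borel (invlim L) =>
    (total_utility beta (utility sigma gamma m) (x : invlim L))%:E in
  let proj : borel (invlim L) -> borel (basic_type L) := invlim_proj L in
  (forall muhat : probability (borel (invlim L)) R,
     invariant_measure (invlim_map L) muhat ->
     (\int[muhat]_x W x =
      ((1 - beta)^-1)%:E * \int[pushforward muhat proj]_x U x)%E) /\
  (hyperbolic L ->
   forall (mu0 : probability (borel (basic_type L)) R)
          (muhat0 : probability (borel (invlim L)) R),
     unique_max_entropy_measure (basic_map L) mu0 ->
     unique_max_entropy_measure (invlim_map L) muhat0 ->
     (forall A, measurable A -> mu0 A = pushforward muhat0 proj A) /\
     (\int[muhat0]_x W x = ((1 - beta)^-1)%:E * \int[mu0]_x U x)%E).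
Proof.
move=> oV cf _ beta01 _ _ _ _ LU U W proj.
have cg := @basic_map_continuous _ _ _ _ L oV cf.
have mproj : measurable_fun [set: borel (invlim L)] proj.
  exact: (measurable_coord 0).
have [M uM] := utility_bounded sigma gamma LU.
have mu_u := measurable_utility sigma gamma LU.
have part1 (muhat : probability (borel (invlim L)) R) :
    invariant_measure (invlim_map L) muhat ->
    (\int[muhat]_x W x =
      ((1 - beta)^-1)%:E * \int[pushforward muhat proj]_x U x)%E.
  move=> inv; rewrite integral_pushforward//; last 2 first.
  - exact/measurable_EFinP.
  - apply: (@bounded_integrable R (invlim L) muhat
      (fun x => utility sigma gamma m (set_val (proj x))) M).
      exact: (measurableT_comp mu_u mproj).
    by move=> x; exact: uM.
  exact: integral_total_utility.
split => // _ mu0 muhat0 [_ mu0_unique] [[inv0 max0] _].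
pose FP := MeasurableFun.Pack (MeasurableFun.Class
  (isMeasurableFun.Build _ _ _ _ proj mproj)).
(* The projected measure is an invariant measure of maximal entropy. *)
pose nu : probability (borel (basic_type L)) R := distribution muhat0 FP.
have nuE A : measurable A -> nu A = muhat0 ((fun x : borel (invlim L) =>
    invlim_coord (x : invlim L) 0 : borel (basic_type L)) @^-1` A) by [].
have mu0E A : measurable A -> mu0 A = pushforward muhat0 proj A.
  move=> mA; rewrite -(mu0_unique nu)//; split.
    exact: (invariant_proj cg inv0 nuE).
  rewrite -(measure_entropy_proj cg inv0 nuE) -(topological_entropy_invlim L).
  exact: max0.
split => //; rewrite part1//; congr (_ * _)%E.
by apply: (eq_measure_integral mu0) => A mA _; exact/esym/mu0E.
Qed.
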